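(* Let $r\ge2$ and $c\ge2$ be integers. Then the partition $[c,2,1^{r-2}]$ is a $\mathcal{P}$-position of the game CRIM if and only if $r$ and $c$ are even.
   Context: A partition is a finite weakly decreasing sequence $\lambda=[\lambda_1,\ldots,\lambda_r]$ of positive integers, called its parts; the empty partition $[\,]$ is allowed. Exponents denote repeated parts, so $[c,2,1^{r-2}]$ has parts $c$, $2$, and $r-2$ parts equal to $1$. The conjugate of $\lambda$ is $\lambda'=[\lambda'_1,\ldots,\lambda'_{\lambda_1}]$, where $\lambda'_k$ is the largest $i$ with $\lambda_i\ge k$. CRIM is the impartial two-player game whose positions are partitions. From $\lambda=[\lambda_1,\ldots,\lambda_r]$, a row move deletes the part $\lambda_i$ for some $1\le i\le r$. A column move takes the conjugate of the partition that results from making a row move on $\lambda'$ (i.e. it removes one column of the Young diagram). Play is normal play: the player to move at the terminal position $[\,]$ loses. A $\mathcal{P}$-position (losing position) is one from which the player who has just moved can force a win. *)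

(* Defs.v *)
From HB Require Import structures.
From mathcomp Require Import all_boot.

Set Implicit Arguments.
Unset Strict Implicit.
Unset Printing Implicit Defensive.

Definition is_partition (s : seq nat) : bool := sorted geq s && all (ltn 0) s.

Record int_partition : Type :=
  Partition { parts :> seq nat; partsP : is_partition parts }.

HB.instance Definition _ := [isSub for parts].
HB.instance Definition _ := [Equality of int_partition by <:].

Definition delete_nth (i : nat) (s : seq nat) : seq nat :=
  take i s ++ drop i.+1 s.

(* The k-th entry (k = 1, ..., s_1) is the largest 1-based index of a part of
   size at least k; nth is 0-based, hence i.+1. *)
Definition conj_seq (s : seq nat) : seq nat :=
  [seq \max_(i < size s | k <= nth 0 s i) i.+1 | k <- iota 1 (head 0 s)].

Lemma delete_nth_is_partition i s :
  is_partition s -> is_partition (delete_nth i s).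
Proof.
case/andP=> s_sorted s_gt0.
have sub : subseq (delete_nth i s) s.
  rewrite -{2}(cat_take_drop i s) /delete_nth cat_subseq //.
  by rewrite -addn1 addnC -drop_drop drop_subseq.
apply/andP; split; last first.
  by apply/allP=> x /(mem_subseq sub); move/allP: s_gt0; apply.
apply: (subseq_sorted _ sub s_sorted) => y x z /= le_yx le_zy.
exact: leq_trans le_zy le_yx.
Qed.

Lemma conj_seq_is_partition s : is_partition (conj_seq s).
Proof.
apply/andP; split.
  rewrite /conj_seq sorted_map.
  apply: (@sub_sorted _ leq); last exact: iota_sorted.
  move=> j k le_jk /=; apply/bigmax_leqP=> i le_ki.
  by rewrite (bigD1 i) /= ?(leq_trans le_jk) // leq_max leqnn.
apply/allP=> _ /mapP[k + ->]; rewrite mem_iota => /andP[k_gt0].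
rewrite addnC addn1 ltnS; case: s => [|a s] /= le_ka.
  by move: k_gt0; rewrite ltnNge le_ka.
rewrite (bigD1 (@ord0 (size s))) //=.
by rewrite leq_max.
Qed.

Definition delete_part (lam : int_partition) (i : nat) : int_partition :=
  Partition (delete_nth_is_partition i (partsP lam)).

Definition conjugate (lam : int_partition) : int_partition :=
  Partition (conj_seq_is_partition lam).

Definition row_move (lam mu : int_partition) : Prop :=
  exists i : 'I_(size lam), mu = delete_part lam i.

Definition column_move (lam mu : int_partition) : Prop :=
  exists2 nu, row_move (conjugate lam) nu & mu = conjugate nu.

Definition crim_move (lam mu : int_partition) : Prop :=
  row_move lam mu \/ column_move lam mu.

(* Normal play: the empty partition has no moves, hence is a P-position. As an
   inductive predicate, membership is witnessed by a (well-founded) winning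
   strategy: for the previous player in P_position, for the next player in
   N_position. *)
Inductive P_position (lam : int_partition) : Prop :=
  | P_intro of forall mu, crim_move lam mu -> N_position mu
with N_position (lam : int_partition) : Prop :=
  | N_intro mu of crim_move lam mu & P_position mu.

Lemma c21_is_partition (r c : nat) :
  2 <= c -> is_partition [:: c, 2 & nseq (r - 2) 1].
Proof.
move=> c_ge2; rewrite /is_partition /= c_ge2 (ltnW c_ge2) all_nseq orbT !andbT /=.
have path_nseq n a : 0 < a -> path geq a (nseq n 1).
  by elim: n a => //= n IHn a a_gt0; rewrite a_gt0 IHn.
by rewrite ?andbT; exact: path_nseq.
Qed.

(* [c, 2, 1^(r-2)], of length r when 2 <= r. *)
Definition c21_partition (r c : nat) (c_ge2 : 2 <= c) : int_partition :=
  Partition (c21_is_partition r c_ge2).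

(* Main.v *)
Require Import Defs.
From mathcomp Require Import all_boot.

(** Write [hook l a] for [[a+1, 1^l]] and [near_hook l a] for [[a+2, 2, 1^l]];
    conjugation exchanges [l] and [a] in both families, and a move from a
    near-hook leads to a hook or to a smaller near-hook.  A hook is lost exactly
    when [l, a > 0] and [l + a] is even: a hook with [l = 0] or [a = 0] is
    emptied in one move, and when [l, a > 0] every other move than to such a
    one-row or one-column hook decreases [l + a] by one.  A near-hook with [l],
    [a] both even has no move to a lost hook; with [l], [a] both odd, deleting
    the first row leaves the lost hook [[2, 1^l]]; with exactly one of them odd,
    decreasing that one makes both even. *)

Set Implicit Arguments.
Unset Strict Implicit.
Unset Printing Implicit Defensive.

(** The two strategies are played against each other: each call applies one to the move chosen by
    the other, and recursion descends in the first derivation. *)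
Fixpoint P_not_N lam (Plam : P_position lam) : N_position lam -> False :=
  let: P_intro all_N := Plam in
  fun '(N_intro mu lam_mu Pmu) => N_not_P (all_N mu lam_mu) Pmu
with N_not_P lam (Nlam : N_position lam) : P_position lam -> False :=
  let: N_intro mu lam_mu Pmu := Nlam in
  fun '(P_intro all_N) => P_not_N Pmu (all_N mu lam_mu).

(** Quantifying over all partitions with underlying sequence [s] lets the analysis run on plain
    sequences, without carrying proofs of [is_partition]. *)
Definition outcome (lost : bool) (s : seq nat) : Prop :=
  forall lam : int_partition,
    parts lam = s -> if lost then P_position lam else N_position lam.

Lemma N_of_row_move i s :
  i < size s -> outcome true (delete_nth i s) -> outcome false s.
Proof.
move=> lt_i Ps lam lamE; rewrite -lamE in lt_i Ps.
by apply: (N_intro _ (Ps (delete_part lam i) erefl)); left; exists (Ordinal lt_i).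
Qed.

Lemma N_of_column_move i s :
    i < size (conj_seq s) ->
    outcome true (conj_seq (delete_nth i (conj_seq s))) ->
  outcome false s.
Proof.
move=> lt_i Ps lam lamE; rewrite -lamE in lt_i Ps.
pose nu := delete_part (conjugate lam) i.
apply: (N_intro _ (Ps (conjugate nu) erefl)); right; exists nu => //.
by exists (Ordinal lt_i).
Qed.

Lemma P_of_moves s :
    (forall i, i < size s -> outcome false (delete_nth i s)) ->
    (forall i, i < size (conj_seq s) ->
       outcome false (conj_seq (delete_nth i (conj_seq s)))) ->
  outcome true s.
Proof.
move=> rowN colN lam lamE; rewrite -lamE in rowN colN; apply: P_intro => mu.
by case=> [[i ->] | [nu [i ->] ->]]; [apply: (rowN i) | apply: (colN i)].
Qed.

Lemma outcome_nil : outcome true [::].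
Proof. by apply: P_of_moves. Qed.

(** In a weakly decreasing sequence the entries at least [k] form an initial segment. The bound on
    [i] excludes the default value [0], which would break the case [k = 0]. *)
Lemma leq_nth_count s k i : sorted geq s -> i < size s ->
  (k <= nth 0 s i) = (i < count (leq k) s).
Proof.
elim: s i => //= x s IHs i path_s.
have /allP le_x : all (geq x) s.
  by apply: order_path_min path_s => y z t le_yz /leq_trans; apply.
have [le_kx | lt_xk] := leqP k x.
  by case: i => [|i] //= lt_i; rewrite add1n ltnS IHs // (path_sorted path_s).
have -> : count (leq k) s = 0.
  apply/eqP; rewrite eqn0Ngt -has_count; apply/hasPn => y /le_x /= le_yx.
  by rewrite -ltnNge (leq_ltn_trans le_yx).
case: i => [|i] /= lt_i; apply/negbTE; rewrite -ltnNge //.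
by apply: leq_ltn_trans lt_xk; apply/le_x/mem_nth.
Qed.

Lemma bigmax_ordS m n : m <= n -> \max_(i < n | i < m) i.+1 = m.
Proof.
move=> le_mn; apply/eqP; rewrite eqn_leq; apply/andP; split.
  exact/bigmax_leqP.
case: m le_mn => // m lt_mn.
by rewrite (@leq_bigmax_cond _ _ (fun i : 'I_n => i.+1) (Ordinal lt_mn)) /=.
Qed.

Lemma conj_seqE s : sorted geq s ->
  conj_seq s = [seq count (leq k) s | k <- iota 1 (head 0 s)].
Proof.
move=> s_sorted; apply: eq_map => k.
rewrite -(bigmax_ordS (count_size (leq k) s)).
by apply: eq_bigl => i; rewrite leq_nth_count.
Qed.

#[local] Arguments delete_nth : simpl never.

Definition hook l a := a.+1 :: nseq l 1.
Definition near_hook l a := [:: a.+2, 2 & nseq l 1].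

Lemma path_geq_nseq1 n x : 0 < x -> path geq x (nseq n 1).
Proof. by elim: n x => //= n IHn x x_gt0; rewrite x_gt0 IHn. Qed.

(** Serves for the columns that meet only the first row. *)
Lemma map_count_iota s m n :
    (forall k, m <= k < m + n -> count (leq k) s = 1) ->
  [seq count (leq k) s | k <- iota m n] = nseq n 1.
Proof.
move=> count1; set t := map _ _.
have -> : n = size t by rewrite size_map size_iota.
apply/all_pred1P; rewrite all_map; apply/allP => k.
by rewrite mem_iota => /count1 /= ->.
Qed.

Lemma conj_hook l a : conj_seq (hook l a) = hook a l.
Proof.
rewrite conj_seqE /= ?path_geq_nseq1 // count_nseq mul1n add1n.
congr (_ :: _); apply: (@map_count_iota (hook l a)) => k; rewrite addSn add1n ltnS.
by case/andP=> k_gt1 le_k; rewrite /= le_k count_nseq leqNgt k_gt1.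
Qed.

Lemma conj_near_hook l a : conj_seq (near_hook l a) = near_hook a l.
Proof.
rewrite conj_seqE /= ?path_geq_nseq1 // !count_nseq mul1n.
congr [:: _, _ & _]; apply: (@map_count_iota (near_hook l a)) => k.
rewrite !addSn add0n ltnS; case/andP=> k_gt2 le_k; rewrite /= le_k count_nseq (leqNgt k 2) k_gt2.
by rewrite (leqNgt k 1) (ltnW k_gt2).
Qed.

Lemma delete_nth_nseq i n (x : nat) :
  i < n -> delete_nth i (nseq n x) = nseq n.-1 x.
Proof.
move=> lt_in; rewrite /delete_nth take_nseq; last exact: ltnW.
rewrite drop_nseq -nseqD; congr nseq.
by case: n lt_in => // n; rewrite ltnS subSS => /subnKC.
Qed.

Lemma delete_nthS i x s : delete_nth i.+1 (x :: s) = x :: delete_nth i s.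
Proof. by []. Qed.

Lemma delete_nth0 x s : delete_nth 0 (x :: s) = s.
Proof. by rewrite /delete_nth take0 drop1. Qed.

Lemma outcome_hook0r a : outcome false (hook 0 a).
Proof. by apply: (@N_of_row_move 0) => //; apply: outcome_nil. Qed.

Lemma outcome_hookr0 l : outcome false (hook l 0).
Proof.
apply: (@N_of_column_move 0); rewrite conj_hook // delete_nth0.
exact: outcome_nil.
Qed.

Lemma outcome_hook l a : outcome [&& 0 < l, 0 < a & ~~ odd (l + a)] (hook l a).
Proof.
have [n] := ubnP (l + a); elim: n l a => // n IHn l a; rewrite ltnS => le_n.
case: l a => [|l] [|a] in le_n *; try exact: outcome_hook0r.
  exact: outcome_hookr0.
have IHl : outcome [&& 0 < l & ~~ odd (l + a.+1)] (hook l a.+1).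
  exact: (IHn l a.+1).
have IHa : outcome [&& 0 < a & ~~ odd (l.+1 + a)] (hook l.+1 a).
  by apply: (IHn l.+1 a); rewrite addSnnS.
(* All three parities become that of [l + a], so one case split settles the hook and both of its
   shortenings. *)
rewrite !(addnS, addSn) /= ?negbK in IHl IHa *.
case: (boolP (odd (l + a))) => odd_la;
    rewrite ?odd_la ?(negPf odd_la) ?andbT ?andbF /= in IHl IHa *; last first.
  apply: P_of_moves => [] [|i]; rewrite ?conj_hook /= ?size_nseq => lt_i.
  - rewrite delete_nth0; exact: outcome_hookr0.
  - by rewrite delete_nthS delete_nth_nseq.
  - exact: outcome_hook0r.
  - by rewrite delete_nthS delete_nth_nseq // conj_hook.
(* A winning shortening must leave both arms nonempty. Here [l] and [a] are one less than the
   original lengths, and [l + a] odd makes one of them positive. *)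
have [l0 | l_gt0] := posnP l; last first.
  apply: (@N_of_row_move 1); rewrite /= ?size_nseq // delete_nthS.
  by rewrite delete_nth_nseq //; rewrite l_gt0 in IHl.
have [a0 | a_gt0] := posnP a; first by rewrite l0 a0 in odd_la.
apply: (@N_of_column_move 1); rewrite conj_hook /= ?size_nseq // delete_nthS.
by rewrite delete_nth_nseq // conj_hook; rewrite a_gt0 in IHa.
Qed.

Lemma outcome_near_hook l a : outcome (~~ odd l && ~~ odd a) (near_hook l a).
Proof.
have [n] := ubnP (l + a); elim: n l a => // n IHn l a; rewrite ltnS => le_n.
have IHl : 0 < l -> outcome (odd l && ~~ odd a) (near_hook l.-1 a).
  case: l le_n => // l le_n _.
  exact: (IHn l a).
have IHa : 0 < a -> outcome (~~ odd l && odd a) (near_hook l a.-1).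
  case: a le_n {IHl} => // a le_n _; rewrite -[odd a.+1]/(~~ odd a).
  by apply: IHn; rewrite -addnS.
(* These hooks result from deleting, in order, the first row, the first column, the second row and
   the second column. *)
have hook_l := @outcome_hook l 1; have hook_a := @outcome_hook 1 a.
have hook_la := @outcome_hook l a.+1; have hook_al := @outcome_hook l.+1 a.
case: (boolP (odd l)) (boolP (odd a)) => [odd_l | even_l] [odd_a | even_a] /=.
- apply: (@N_of_row_move 0); rewrite // delete_nth0.
  by move: hook_l; rewrite addn1 /= odd_l odd_gt0.
(* Index 2 is the first part equal to 1 after the two large parts; it exists because [l] is odd. *)
- apply: (@N_of_row_move 2).
    by rewrite /= size_nseq !ltnS odd_gt0.
  rewrite !delete_nthS delete_nth_nseq ?odd_gt0 //.
  by move: IHl; rewrite odd_l even_a odd_gt0 //; apply.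
- apply: (@N_of_column_move 2); rewrite conj_near_hook.
    by rewrite /= size_nseq !ltnS odd_gt0.
  rewrite !delete_nthS delete_nth_nseq ?odd_gt0 // conj_near_hook.
  by move: IHa; rewrite even_l odd_a odd_gt0 //; apply.
rewrite ?addn1 ?addnS ?addSn /= ?oddD ?(negPf even_l) ?(negPf even_a) ?andbF
  in hook_l hook_a hook_la hook_al.
rewrite (negPf even_l) (negPf even_a) in IHl IHa.
apply: P_of_moves => [] [|[|i]]; rewrite ?conj_near_hook /= ?size_nseq => lt_i.
- by rewrite delete_nth0.
- by rewrite delete_nthS delete_nth0.
- rewrite !delete_nthS delete_nth_nseq //; apply: IHl.
  by case: (l) lt_i.
- by rewrite delete_nth0 (conj_hook a 1).
- by rewrite delete_nthS delete_nth0 (conj_hook a l.+1).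
- rewrite !delete_nthS delete_nth_nseq // (conj_near_hook a.-1 l); apply: IHa.
  by case: (a) lt_i.
Qed.

Theorem proposition12 (r c : nat) (r_ge2 : 2 <= r) (c_ge2 : 2 <= c) :
  P_position (c21_partition r c_ge2) <-> ~~ odd r /\ ~~ odd c.
Proof.
have lamE : parts (c21_partition r c_ge2) = near_hook (r - 2) (c - 2).
  by rewrite /near_hook -(addn2 (c - 2)) subnK.
(* Subtracting 2 preserves the parities of [r] and [c]. *)
have := outcome_near_hook lamE; rewrite (oddB r_ge2) (oddB c_ge2) !addbF.
case: andP => [even_rc | odd_rc] out; split => // Plam.
by case: (P_not_N Plam out).
Qed.
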